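(* Let $a\ge 2$ be an integer, and let $p_t(x)/q_t(x)$ be the convergents of the series $g_2(x)$. Assume that there exist positive integers $n_0,t,p$ such that 1. $p$ is an odd prime number and $p\,\|\,a^{2^{n_0}}-1$; 2. $|\Gamma(2,p^2)|=p\,|\Gamma(2,p)|$; 3. $q_t(a^{2^{n_0}})\equiv 0\pmod{p^2}$; 4. $q_t'(1)\not\equiv 0\pmod p$. Then the real number $f_2(a)$ is not badly approximable.
   Context: Define the Laurent series $f_2(x)=\prod_{t=0}^{\infty}(1-x^{-2^t})\in\mathbb{Q}((x^{-1}))$, which converges for $|x|>1$, and $g_2(x)=x^{-1}f_2(x)$. Thus $f_2(a)=\prod_{t\ge0}(1-a^{-2^t})\in\mathbb{R}$. The series $g_2(x)$ has a continued fraction expansion $[a_0(x);a_1(x),a_2(x),\ldots]$ with $a_i(x)\in\mathbb{Q}[x]$, $a_i$ non-constant for $i\ge1$; its $t$-th convergent ($t\ge 0$) is $p_t(x)/q_t(x)=[a_0(x);a_1(x),\ldots,a_t(x)]$ in reduced form. The pair $(p_t,q_t)$ is defined up to a common non-zero constant, and is scaled so that $p_t,q_t\in\mathbb{Z}[x]$. $q_t'$ denotes the derivative of $q_t$. $p\,\|\,b$ means that $p$ divides $b$ but $p^2$ does not. $\Gamma(b,p^k)$ denotes the multiplicative subgroup of $(\mathbb{Z}/p^k\mathbb{Z})^*$ generated by $b$. A real number $\xi$ is badly approximable if there is a constant $c=c(\xi)>0$ such that $0<|\xi-r/s|$ and $|\xi-r/s|\ge c/s^2$ for all integers $r,s$ with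 $s\ne0$. *)

(* Defs.v *)
From HB Require Import structures.
From mathcomp Require Import all_boot all_order all_algebra all_fingroup.
From mathcomp Require Import all_classical all_reals all_analysis.
Set Implicit Arguments.
Unset Strict Implicit.
Unset Printing Implicit Defensive.
Import Order.TTheory GRing.Theory Num.Theory.
Import numFieldNormedType.Exports.
Local Open Scope ring_scope.

(** * Laurent series in 1/x over the rationals *)

(* [f n] is the coefficient of x^n; an element of Q((1/x)) is an [f : lser]
   satisfying [is_laurent f]. *)
Definition lser := int -> rat.

Definition is_laurent (f : lser) : Prop :=
  exists d : int, forall n : int, d < n -> f n = 0.

(* Cauchy product. [\sum_(i \in A)] is the sum of a finitely supported family;
   the support is finite as soon as f and g satisfy [is_laurent]. *)
Definition lmul (f g : lser) : lser :=
  fun n => \sum_(i \in [set: int]%classic) f i * g (n - i).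

Definition lser_of_poly (p : {poly rat}) : lser :=
  fun n => if n is Posz k then p`_k else 0.

(** * The series f_2 and g_2 *)

(* In the variable y = 1/x. *)
Definition f2_partial (N : nat) : {poly rat} :=
  \prod_(t < N) (1 - 'X^(2 ^ t)).

(* The factors of index t with 2^t > k do not affect the coefficient of y^k, so
   the infinite product converges coefficientwise, and its coefficient of y^k is
   read off any partial product with at least k.+1 factors; see [f2_partialE]. *)
Definition f2 : lser :=
  fun n => if n <= 0 then (f2_partial `|n|%N.+1)`_(`|n|%N) else 0.

Lemma f2_partialE (k N : nat) : (k < N)%N -> (f2_partial N)`_k = f2 (- k%:Z).
Proof.
move=> kN; rewrite /f2 oppr_le0 le0z_nat abszN absz_nat.
elim: N kN => // N IHN; rewrite ltnS leq_eqVlt => /orP[/eqP-> //|kN].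
rewrite -(IHN kN) /f2_partial big_ord_recr /= mulrBr mulr1 coefB coefMXn.
by rewrite (ltn_trans kN (ltn_expl N (ltnSn 1))) subr0.
Qed.

(* g_2 = x^{-1} f_2, the product by x^{-1} being a shift of the coefficients. *)
Definition g2 : lser := fun n => f2 (n + 1).

(* The real number f_2(x), for x > 1. *)
Definition f2_partial_real (R : realType) (x : R) (N : nat) : R :=
  \prod_(t < N) (1 - x ^- (2 ^ t)).

Definition f2_real (R : realType) (x : R) : R := limn (f2_partial_real x).

Lemma cvg_f2_partial_real (R : realType) (x : R) :
  1 < x -> cvgn (f2_partial_real x).
Proof.
move=> x1; have x0 : 0 < x := lt_trans ltr01 x1.
have fac t : 0 <= 1 - x ^- (2 ^ t) <= 1.
  rewrite subr_ge0 lerBlDr lerDl invr_ge0 exprn_ge0 ?(ltW x0)// andbT.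
  by rewrite invf_le1 ?exprn_gt0// exprn_ege1 ?ltW.
have P0 N : 0 <= f2_partial_real x N.
  by apply: prodr_ge0 => t _; case/andP: (fac t).
apply: nonincreasing_is_cvgn; last by exists 0 => _ [N _ <-].
apply/nonincreasing_seqP => N.
rewrite /f2_partial_real big_ord_recr /= ler_piMr//; first exact: P0.
by case/andP: (fac N).
Qed.

(** * Continued fractions and convergents *)

(* g = [A 0; A 1, A 2, ...]: with the complete quotients alpha 0 = g and
   alpha (i+1) = 1 / (alpha i - A i), the partial quotient A i is the polynomial
   part of alpha i. *)
Definition cf_expansion (g : lser) (A : nat -> {poly rat}) : Prop :=
  (forall i, (1 < size (A i.+1))%N) /\
  exists alpha : nat -> lser,
    [/\ alpha 0%N = g,
        forall i, is_laurent (alpha i),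
        forall i (k : nat), alpha i k%:Z = (A i)`_k &
        forall i, lmul (fun n => alpha i n - lser_of_poly (A i) n)
                       (alpha i.+1) = lser_of_poly 1].

(* The finite continued fraction [A 0; A 1, ..., A t] in Q(x). *)
Fixpoint cf_finite (A : nat -> {poly rat}) (t : nat) : {fraction {poly rat}} :=
  if t is t'.+1 then tofrac (A 0%N) + (cf_finite (fun i => A i.+1) t')^-1
  else tofrac (A 0%N).

Definition polyZtoQ (p : {poly int}) : {poly rat} := map_poly intr p.

(* P/Q is the t-th convergent, in lowest terms over Q and with integer
   coefficients; the remaining common constant factor is left free. *)
Definition is_convergent (A : nat -> {poly rat}) (t : nat) (P Q : {poly int}) :
    Prop :=
  [/\ Q != 0, coprimep (polyZtoQ P) (polyZtoQ Q) &
      tofrac (polyZtoQ P) / tofrac (polyZtoQ Q) = cf_finite A t].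

(** * Arithmetic notions *)

Definition exactly_divides (p b : int) : bool :=
  (p %| b)%Z && ~~ (p ^+ 2 %| b)%Z.

(* The subgroup of (Z/p^kZ)^* generated by b; the generating set is the single
   residue of b when b is prime to p. *)
Definition Gamma (b p k : nat) : {set {unit 'Z_(p ^ k)}} :=
  <<[set u : {unit 'Z_(p ^ k)} | val u == b%:R :> 'Z_(p ^ k)]>>%g.

Definition badly_approximable (R : realType) (xi : R) : Prop :=
  exists c : R, 0 < c /\
    forall r s : int, s != 0 ->
      0 < `|xi - r%:~R / s%:~R| /\ c / s%:~R ^+ 2 <= `|xi - r%:~R / s%:~R|.

(* Main.v *)
Require Import Defs.
From mathcomp Require Import all_boot all_order all_algebra all_fingroup.
From mathcomp Require Import all_classical all_reals all_analysis.
From mathcomp Require Import cyclic ring zify.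
Import Order.TTheory GRing.Theory Num.Theory.
Local Open Scope ring_scope.

(** The functional equation
      [f_2(x) = f_2(x^(2^n)) * \prod_(i < n) (1 - x^-(2^i))]
    turns one convergent [P/Q] of [g_2] into infinitely many rational
    approximations of [f_2(a)]. With [z = a^(2^n)] and
    [V_n = \prod_(i < n) ('X^(2^i) - 1)] ([f2_numer]), the fraction
      [a * V_n(a) * P(z) / Q(z)]
    is close to [f_2(a)]: since [P/Q] is a convergent, [Q g_2 - P] has order at
    least [deg Q + 1] in [1/x] ([convergent_approx]), and this makes the distance
    at most a constant times [Q(z)^-2], where the constant depends on [Q] but
    not on [n] ([f2_real_approx]). This alone is the quality of a generic
    approximation. If however [V_n(a)] and [Q(z)] have a common factor [D], the
    fraction can be simplified by [D], and the distance becomes smaller than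
    [1 / denominator^2] by a factor of order [D^2]
    ([approximation_quality]). So it suffices to find [n] for which [D] is as
    large as desired.

    The arithmetic hypotheses provide [D = p^k]. The prime [p] divides
    [a^(2^i) - 1] for every [i >= n0], so [p^(n - n0)] divides [V_n(a)]
    ([f2_numer_dvd]). For [Q(z)], put [b = a^(2^n0)]. As [b = 1] modulo [p] and
    [Q'(1)] is a unit modulo [p], Hensel's lemma yields a [p]-adic root of [Q]
    congruent to [b] modulo [p^2]. Since [p] divides [b - 1] exactly, this root is
    [b^s] for a [p]-adic integer [s] congruent to 1 modulo [p]. By the hypothesis
    on the orders of 2, the powers of 2 are dense among such [s]; hence
    [Q(b^(2^m))] is divisible by [p^k] for suitable large [m]. The proof
    ([lift_power_root]) does this without [p]-adic numbers, gaining one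
    factor [p] at a time by a Newton step in the exponent [m]. *)

(** * Powers modulo powers of an odd prime *)

Lemma expr1D_order3 {R : comPzRingType} (y : R) (N : nat) :
  exists w, (1 + y) ^+ N = 1 + y *+ N + y ^+ 2 *+ 'C(N, 2) + y ^+ 3 * w.
Proof.
elim: N => [|N [w IHN]].
  by exists 0; rewrite bin0n /= !mulr0n mulr0 !addr0 expr0.
exists (w * (1 + y) + 'C(N, 2)%:R).
by rewrite exprS IHN binS bin1; ring.
Qed.

(** Raising to the power [p] moves a deviation from 1 up by exactly one [p]-adic
    digit. Oddness of [p] enters when [j = 1], through [p] dividing
    ['C(p, 2)]. *)
Lemma expr1D_prime (p j : nat) (u : int) : prime p -> odd p -> (0 < j)%N ->
  exists2 u', (1 + p%:Z ^+ j * u) ^+ p = 1 + p%:Z ^+ j.+1 * u' &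
    (p%:Z %| u' - u)%Z.
Proof.
move=> pp op j0; have [w ->] := expr1D_order3 (p%:Z ^+ j * u) p.
have p2 : (2 < p)%N by case: p pp op => [|[|[|]]].
have /dvdnP[c ->] : (p %| 'C(p, 2))%N by apply: prime_dvd_bin; rewrite ?p2.
case: j j0 => // j _.
exists (u + p%:Z * (p%:Z ^+ j * u ^+ 2 * c%:Z + p%:Z ^+ j * p%:Z ^+ j * u ^+ 3 * w)).
  by rewrite !exprS; ring.
by rewrite addrC addKr; apply: dvdz_mulr.
Qed.

(** The exponent [p^i * w] changes the leading digit [u] into [w * u] and moves
    it up by [i] places: the first-order form of the [p]-adic logarithm. *)
Lemma expr1D_pfactor (p j i w : nat) (u : int) : prime p -> odd p -> (0 < j)%N ->
  exists2 u', (1 + p%:Z ^+ j * u) ^+ (p ^ i * w) = 1 + p%:Z ^+ (i + j) * u' &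
    (p%:Z %| u' - w%:Z * u)%Z.
Proof.
move=> pp op j0; rewrite exprM.
have [v -> vu] : exists2 v, (1 + p%:Z ^+ j * u) ^+ (p ^ i) = 1 + p%:Z ^+ (i + j) * v &
    (p%:Z %| v - u)%Z.
  elim: i => [|i [v IH vu]].
    by exists u; rewrite ?subrr ?dvdz0// expn0 expr1.
  have ij0 : (0 < i + j)%N by rewrite addn_gt0 j0 orbT.
  have [v' e v'v] := expr1D_prime p (i + j) v pp op ij0.
  exists v'; first by rewrite expnSr exprM IH e.
  by rewrite -(subrKA v); apply: rpredD.
have [r ->] := expr1D_order3 (p%:Z ^+ (i + j) * v) w.
case: j j0 => // j _; rewrite addnS.
exists (v * w%:Z + p%:Z * (p%:Z ^+ (i + j) * v ^+ 2 * 'C(w, 2)%:Z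
         + p%:Z ^+ (i + j) * p%:Z ^+ (i + j).+1 * v ^+ 3 * r)).
  by rewrite !exprS; ring.
rewrite -addrA addrCA; apply: rpredD; first exact: dvdz_mulr.
by rewrite mulrC -mulrBr; apply: dvdz_mull.
Qed.

Lemma horner_taylor2 {R : comNzRingType} (q : {poly R}) (x h : R) :
  exists r, q.[x + h] = q.[x] + h * q^`().[x] + h ^+ 2 * r.
Proof.
elim/poly_ind: q => [|q c [r IH]].
  by exists 0; rewrite deriv0 !horner0 !mulr0 !addr0.
exists (r * (x + h) + q^`().[x]).
by rewrite derivD derivC derivM derivX !hornerE IH; ring.
Qed.

Lemma dvdz_horner_sub (q : {poly int}) (d x y : int) :
  (d %| x - y)%Z -> (d %| q.[x] - q.[y])%Z.
Proof.
move=> dxy; have [r e] := horner_taylor2 q y (x - y).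
move: e; rewrite addrC subrK => ->; apply/dvdzP.
have /dvdzP[c ->] := dxy; exists (c * q^`().[y] + c ^+ 2 * d * r).
by ring.
Qed.

Lemma solve_linear_mod (p : nat) (v c : int) : prime p -> ~~ (p%:Z %| c)%Z ->
  exists2 l : nat, (0 < l)%N & (p%:Z %| v + l%:Z * c)%Z.
Proof.
move=> pp pc; have p0 : p%:Z != 0 by case: p pp {pc}.
have [x [y e]] : exists x y, x * p%:Z + y * c = 1.
  have /eqP <- : coprimez p%:Z c.
    by rewrite /coprimez/gcdz/= eqz_nat -/(coprime _ _) prime_coprime.
  by have [x [y e]] := Bezoutz p%:Z c; exists x, y.
have m0 : 0 <= (- v * y %% p%:Z)%Z by apply: modz_ge0.
exists (`|(- v * y %% p%:Z)%Z|%N + p)%N; first by rewrite addn_gt0 (prime_gt0 pp) orbT.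
rewrite PoszD gez0_abs //.
have -> : (- v * y %% p%:Z)%Z = - v * y - (- v * y %/ p%:Z)%Z * p%:Z.
  by rewrite [X in X - _](divz_eq (- v * y) p%:Z) [_ + (_ %% _)%Z]addrC addrK.
set t := (_ %/ _)%Z; apply/dvdzP; exists (v * x - t * c + c).
by rewrite -{1}[v]mulr1 -e; ring.
Qed.

(** One step replaces [m] by [m + E], where [2^E = 1 + p^(k+1) * w'] is a power of
    [2^e]. With [z = b^(2^m)] this multiplies [z] by
    [z^(p^(k+1) * w') = 1 + p^(k+2) * u'], hence changes [q(z)] by
    [p^(k+2) * u' * q'(1)] to first order. The residue of [u'] modulo [p] is
    [l * w0 * u], where [l] is free and [w0], [u], [q'(1)] are units, so
    [l] can be chosen to cancel the next digit of [q(z)]. *)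
Lemma lift_power_root (p e : nat) (q : {poly int}) (b w0 : int) :
  prime p -> odd p -> (0 < e)%N ->
  2%:Z ^+ e = 1 + p%:Z * w0 -> ~~ (p%:Z %| w0)%Z ->
  exactly_divides p%:Z (b - 1) ->
  (p%:Z ^+ 2 %| q.[b])%Z -> ~~ (p%:Z %| q^`().[1])%Z ->
  forall k, exists2 m : nat, (k <= m)%N & (p%:Z ^+ k.+2 %| q.[b ^+ (2 ^ m)])%Z.
Proof.
move=> pp op e0 e2 pw0 /andP[/dvdzP[u0 bu0] pb] qb q1.
have {pb} pu0 : ~~ (p%:Z %| u0)%Z.
  by apply: contra pb; rewrite bu0 expr2 => pu; apply: dvdz_mul.
have {}bu0 : b = 1 + p%:Z ^+ 1 * u0 by rewrite expr1 mulrC -bu0 addrC subrK.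
have p2 : ~~ (p %| 2)%N.
  rewrite dvdn_prime2//; apply: contraL op => /eqP->.
  by [].
have Euclid (x y : int) : (p%:Z %| x * y)%Z = (p%:Z %| x)%Z || (p%:Z %| y)%Z.
  by rewrite !dvdzE/= abszM Euclid_dvdM.
elim=> [|k [m km IH]]; first by exists 0%N => //; rewrite expn0 expr1.
have [u zu uu0] := expr1D_pfactor p 1 0 (2 ^ m) u0 pp op isT.
rewrite expn0 mul1n add0n -bu0 expr1 in zu.
have {uu0} pu : ~~ (p%:Z %| u)%Z.
  apply/negP => pu; have : (p%:Z %| (2 ^ m)%N%:Z * u0)%Z.
    by rewrite -[X in (_ %| X)%Z](subKr u); apply: rpredB.
  by rewrite Euclid (negPf pu0) orbF dvdzE/= Euclid_dvdX// (negPf p2).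
set z := b ^+ (2 ^ m) in IH zu.
have z1 : (p%:Z %| z - 1)%Z by rewrite zu addrC addKr; apply: dvdz_mulr.
have /dvdzP[v qz] := IH.
have pc : ~~ (p%:Z %| w0 * u * q^`().[1])%Z by rewrite !Euclid !negb_or pw0 pu.
(* [l] cancels the digit [v] of [q(z)]; [0 < l] makes [m] grow. *)
have [l l0 pl] := solve_linear_mod p v _ pp pc.
have [w' ew w'w] := expr1D_pfactor p 1 k l w0 pp op isT.
rewrite expr1 -e2 -exprM in ew.
set E := (e * (p ^ k * l))%N in ew.
have E0 : (0 < E)%N by rewrite !muln_gt0 e0 expn_gt0 prime_gt0.
have [w'n ew'] : exists w'n : nat, w' = w'n%:Z.
  exists `|w'|%N; rewrite gez0_abs //.
  have : 0 < p%:Z ^+ (k + 1) by rewrite exprn_gt0// ltz_nat prime_gt0.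
  move/pmulr_rge0 <-; rewrite -(lerD2l 1) addr0 -ew; lia.
subst w'.
have eE : (2 ^ E = 1 + p ^ k.+1 * w'n)%N.
  apply/eqP; rewrite -eqz_nat; apply/eqP.
  have PoszX (x y : nat) : (x ^ y)%N%:Z = x%:Z ^+ y.
    by rewrite -natz natrX natz.
  by rewrite PoszD PoszM !PoszX ew addn1.
have [u' eu uw'] := expr1D_pfactor p 1 k.+1 w'n u pp op isT.
rewrite expr1 -zu addn1 in eu.
exists (m + E)%N; first by rewrite -addn1 leq_add.
rewrite expnD exprM -/z eE exprD expr1 eu mulrDr mulr1.
have [r ->] := horner_taylor2 q z (z * (p%:Z ^+ k.+2 * u')).
rewrite qz.
have -> : v * p%:Z ^+ k.+2 + z * (p%:Z ^+ k.+2 * u') * q^`().[z]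
    + (z * (p%:Z ^+ k.+2 * u')) ^+ 2 * r =
  p%:Z ^+ k.+2 * ((v + z * u' * q^`().[z]) + p%:Z * (p%:Z ^+ k.+1 * z ^+ 2 * u' ^+ 2 * r)).
  by rewrite !exprS; ring.
rewrite (exprSr _ k.+2); apply: dvdz_mul => //; apply: rpredD; last exact: dvdz_mulr.
(* The bracket is compared modulo [p] with [v + l * (w0 * u * q'(1))]. *)
have /dvdzP[s1 e1] := z1.
have /dvdzP[s2 e2'] := dvdz_horner_sub q^`() _ _ _ z1.
have /dvdzP[s3 e3] := uw'.
have /dvdzP[s4 e4] := w'w.
have /dvdzP[s5 e5] := pl.
have -> : z = 1 + s1 * p%:Z by rewrite -e1 addrC subrK.
have -> : q^`().[1 + s1 * p%:Z] = q^`().[1] + s2 * p%:Z.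
  by rewrite -e2' -e1 [1 + _]addrC subrK [RHS]addrC subrK.
have -> : u' = w'n%:Z * u + s3 * p%:Z by rewrite -e3 addrC subrK.
have -> : w'n%:Z = l%:Z * w0 + s4 * p%:Z by rewrite -e4 addrC subrK.
have -> : v = s5 * p%:Z - l%:Z * (w0 * u * q^`().[1]) by rewrite -e5 addrK.
set dq1 := q^`().[1].
apply/dvdzP.
exists (s5 + (s1 * ((l%:Z * w0 + s4 * p%:Z) * u + s3 * p%:Z) * (dq1 + s2 * p%:Z))
  + (l%:Z * w0 * u * s2 + (s4 * u + s3) * (dq1 + s2 * p%:Z))).
by ring.
Qed.

Lemma Gamma_two_unit (p k : nat) : prime p -> odd p -> (0 < k)%N ->
  exists2 u : {unit 'Z_(p ^ k)}, val u = 2%:R & Gamma 2 p k = <[u]>%g.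
Proof.
move=> pp op k0.
have pk1 : (1 < p ^ k)%N by rewrite -(exp1n k) ltn_exp2r ?prime_gt1.
have u2 : (2%:R : 'Z_(p ^ k)) \is a GRing.unit.
  by rewrite unitZpE// coprimeXl// coprimen2.
exists (FinRing.unit _ u2) => //.
rewrite /Gamma; congr (<<_>>)%g; apply/setP => v.
by rewrite !inE -val_eqE.
Qed.

(** If [2^e], for [e] the order of 2 modulo [p], were 1 modulo [p^2], the order
    would not grow from modulus [p] to modulus [p^2]. *)
Lemma two_order_lift (p : nat) : prime p -> odd p ->
  #|Gamma 2 p 2| = (p * #|Gamma 2 p 1|)%N ->
  exists e w, [/\ (0 < e)%N, 2%:Z ^+ e = 1 + p%:Z * w & ~~ (p%:Z %| w)%Z].
Proof.
move=> pp op.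
have [u1 v1 ->] := Gamma_two_unit p 1 pp op isT.
have [u2 v2 ->] := Gamma_two_unit p 2 pp op isT.
set e := #|<[u1]>%g| => card2.
have e0 : (0 < e)%N by exact: order_gt0.
have pow (k n : nat) (u : {unit 'Z_(p ^ k)}) : (0 < k)%N -> val u = 2%:R ->
    (u ^+ n == 1)%g = (2 ^ n == 1 %[mod p ^ k]).
  move=> k0 vu; have pk1 : (1 < p ^ k)%N by rewrite -(exp1n k) ltn_exp2r ?prime_gt1.
  rewrite -val_eqE FinRing.val_unitX /= vu -natrX -val_eqE /= !val_Zp_nat//.
  by rewrite Zp_cast.
have dvd_pow (k : nat) : (2 ^ e == 1 %[mod p ^ k]) = (p%:Z ^+ k %| 2%:Z ^+ e - 1)%Z.
  rewrite eqn_mod_dvd ?expn_gt0// dvdzE /= abszX.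
  by rewrite -[2%:Z ^+ e]/(2%:R ^+ e) -natrX natz subzn ?expn_gt0.
have /dvdzP[w ew] : (p%:Z ^+ 1 %| 2%:Z ^+ e - 1)%Z.
  by rewrite -dvd_pow -(pow 1%N e u1) //; apply/eqP; apply: expg_order.
exists e, w; split => //; first by rewrite mulrC -[w * _]/(w * p%:Z ^+ 1) -ew addrC subrK.
apply/negP => pw.
have : (#[u2]%g %| e)%N.
  rewrite order_dvdn (pow 2%N e u2) // dvd_pow ew expr1 expr2.
  by apply: dvdz_mul.
move/(dvdn_leq e0); rewrite /order card2 leqNgt -{1}[e]mul1n ltn_mul2r e0.
by rewrite prime_gt1.
Qed.

(** * Convergents of a Laurent series *)

Definition deg_le (f : lser) (d : int) : Prop := forall n, d < n -> f n = 0.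

(** The product of a polynomial and a Laurent series, written as a finite sum so
    that no support condition on the series is required. *)
Definition poly_act (q : {poly rat}) (f : lser) : lser :=
  fun n => \sum_(k < size q) q`_k * f (n - k%:Z).

Lemma poly_act_widen (q : {poly rat}) (f : lser) (n : int) (N : nat) :
  (size q <= N)%N -> poly_act q f n = \sum_(k < N) q`_k * f (n - k%:Z).
Proof.
move=> qN; rewrite /poly_act (big_ord_widen _ (fun k => q`_k * f (n - k%:Z)) qN).
rewrite big_mkcond; apply: eq_bigr => k _; case: ltnP => // qk.
by rewrite nth_default ?mul0r.
Qed.

Lemma lmul_seq (f g : lser) (n : int) (s : seq int) : uniq s ->
  (forall i, i \notin s -> f i * g (n - i) = 0) ->
  lmul f g n = \sum_(i <- s) f i * g (n - i).
Proof.
move=> us out; rewrite /lmul (fsbigE s) //; last by move=> i _; apply: out.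
by apply: eq_bigl => i; rewrite in_setT.
Qed.

(** Under degree bounds the product is a finite sum over any range [N] that is
    large enough; the freedom in [d], [e] and [N] allows products
    with different bounds to be put over one common range. *)
Lemma lmulE (f g : lser) (d e n : int) (N : nat) :
  deg_le f d -> deg_le g e -> d + e - n < N%:Z ->
  lmul f g n = \sum_(j < N) f (d - j%:Z) * g (n - (d - j%:Z)).
Proof.
move=> fd ge dN.
rewrite (lmul_seq f g n [seq d - j%:Z | j <- iota 0 N]).
- by rewrite big_map -[X in iota 0 X]subn0 -/(index_iota 0 N) big_mkord.
- by rewrite map_inj_uniq ?iota_uniq// => i j /addrI/oppr_inj[].
move=> i ni; have [di|id] := ltP d i; first by rewrite fd ?mul0r.
rewrite ge ?mulr0//; suff : (N <= `|d - i|)%N by lia.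
rewrite leqNgt; apply: contra ni => iN; apply/mapP.
by exists `|d - i|%N; [rewrite mem_iota|lia].
Qed.

Lemma lmul_polyr (f : lser) (p : {poly rat}) (n : int) :
  lmul f (lser_of_poly p) n = poly_act p f n.
Proof.
rewrite (lmul_seq f _ n [seq n - k%:Z | k <- iota 0 (size p)]).
- rewrite big_map -[X in iota 0 X]subn0 -/(index_iota 0 _) big_mkord.
  by apply: eq_bigr => k _; rewrite subKr mulrC.
- by rewrite map_inj_uniq ?iota_uniq// => i j /addrI/oppr_inj[].
move=> i ni; case E: (n - i) => [k|k] /=; last by rewrite mulr0.
rewrite nth_default ?mulr0// leqNgt; apply: contra ni => kp; apply/mapP.
by exists k; [rewrite mem_iota|rewrite -E subKr].
Qed.

Lemma poly_act_deg (q : {poly rat}) (f : lser) (d : int) :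
  deg_le f d -> deg_le (poly_act q f) (d + (size q)%:Z).
Proof.
move=> fd n dn; rewrite /poly_act big1// => k _; rewrite fd ?mulr0//.
have := ltn_ord k; lia.
Qed.

Lemma poly_act_lmul (q : {poly rat}) (f g : lser) (n : int) :
  is_laurent f -> is_laurent g -> poly_act q (lmul f g) n = lmul f (poly_act q g) n.
Proof.
move=> [d fd] [e ge].
pose N := (absz (d + (e + (size q)%:Z) - n)%R).+1.
rewrite (@lmulE f _ d (e + (size q)%:Z) n N) //; [|exact: poly_act_deg|rewrite /N; lia].
rewrite /poly_act.
under eq_bigr => k _.
  rewrite (@lmulE f g d e (n - k%:Z) N) //; last by rewrite /N; have := ltn_ord k; lia.
  rewrite mulr_sumr; over.
rewrite exchange_big; apply: eq_bigr => j _; rewrite mulr_sumr.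
apply: eq_bigr => k _; rewrite mulrCA; congr (_ * (_ * g _)).
by rewrite addrAC.
Qed.

Lemma lmulBr (f g h : lser) (n : int) :
  is_laurent f -> is_laurent g -> is_laurent h ->
  lmul f (fun m => g m - h m) n = lmul f g n - lmul f h n.
Proof.
move=> [d fd] [e ge] [e' he].
pose N := (absz (d + Num.max e e' - n)%R).+1.
have [le1 le2] : e <= Num.max e e' /\ e' <= Num.max e e'.
  by rewrite !le_max !lexx orbT.
have gm : deg_le g (Num.max e e') by move=> m em; apply: ge; apply: le_lt_trans em.
have hm : deg_le h (Num.max e e') by move=> m em; apply: he; apply: le_lt_trans em.
have Nb : d + Num.max e e' - n < N%:Z by rewrite /N; lia.
rewrite (lmulE f g _ _ _ _ fd gm Nb) (lmulE f h _ _ _ _ fd hm Nb).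
rewrite (lmulE f _ d (Num.max e e') n N) //; last by move=> m em; rewrite gm// hm// subr0.
by rewrite -sumrB; apply: eq_bigr => j _; rewrite mulrBr.
Qed.

Lemma lmul_deg (f g : lser) (d e : int) :
  deg_le f d -> deg_le g e -> deg_le (lmul f g) (d + e).
Proof.
move=> fd ge n den; rewrite (lmulE f g d e n 0) ?big_ord0//; lia.
Qed.

Lemma lser_of_poly_deg (p : {poly rat}) : deg_le (lser_of_poly p) (size p)%:Z.
Proof. by move=> [k|k] //= pk; rewrite nth_default// ltnW. Qed.

(** The leading coefficient of [f] times that of [g] is a coefficient of [f g],
    so a degree of [f] above [- D] would create a nonzero coefficient of
    positive degree. *)
Lemma deg_inverse (f g : lser) (D : int) : is_laurent f -> deg_le g D ->
  g D != 0 -> (forall n, 0 < n -> lmul f g n = 0) -> deg_le f (- D).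
Proof.
move=> [d fd] gD gD0 fg.
have [m em] : exists m : nat, absz (d + D)%R = m by eexists.
elim: m d fd em => [|m IH] d fd em; first by move=> n nD; apply: fd; lia.
have [dD|Dd] := leP d (- D); first by move=> n nD; apply: fd; lia.
apply: (IH (d - 1)); last by lia.
move=> n dn; have [/fd//|nd] := ltP d n; have -> : n = d by lia.
(* The top coefficient of [f g] is [f d * g D]. *)
apply/eqP; rewrite -(mulIr_eq0 _ (mulIf gD0)); apply/eqP.
have <- : lmul f g (d + D) = f d * g D.
  rewrite (lmulE f g d D (d + D) 1) //; last by lia.
  by rewrite big_ord1 subr0 addrC addKr.
apply: fg; lia.
Qed.

Lemma poly_act_poly (p q : {poly rat}) (n : int) :
  poly_act q (lser_of_poly p) n = lser_of_poly (q * p) n.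
Proof.
case: n => n /=; last first.
  rewrite /poly_act big1// => k _; case E: (Negz n - k%:Z) => [m|m] /=; first by lia.
  by rewrite mulr0.
rewrite (@poly_act_widen _ _ _ (size q + n.+1)) ?leq_addr// coefM.
rewrite (big_ord_widen (size q + n.+1) (fun k => q`_k * p`_(n - k))) ?leq_addl//.
rewrite [RHS]big_mkcond; apply: eq_bigr => k _; rewrite ltnS; case: leqP => kn.
  by rewrite subzn.
by case E: (n%:Z - k%:Z) => [m|m] /=; [lia|rewrite mulr0].
Qed.

(** Let [p/q] be the convergent of the shifted expansion, whose series is
    [alpha 1 = 1 / r] with [r = alpha 0 - A 0]. The next convergent is
    [(A 0 * p + q) / p], and its remainder is
      [p * alpha 0 - (A 0 * p + q) = p * r - q = - r * (q * alpha 1 - p)],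
    so its degree is the previous one lowered by the degree of [A 1],
    exactly as much as the degree of the denominator grows. *)
Lemma cf_finite_approx (t : nat) (A : nat -> {poly rat}) (alpha : nat -> lser) :
  (forall i, (1 < size (A i.+1))%N) -> (forall i, is_laurent (alpha i)) ->
  (forall i (k : nat), alpha i k%:Z = (A i)`_k) ->
  (forall i, lmul (fun n => alpha i n - lser_of_poly (A i) n) (alpha i.+1)
             = lser_of_poly 1) ->
  exists p q : {poly rat},
    [/\ coprimep p q, q != 0, tofrac p / tofrac q = cf_finite A t,
        (1 < size (A 0%N))%N -> size p = (size q + (size (A 0%N)).-1)%N &
        forall n, - (size q)%:Z < n -> poly_act q (alpha 0%N) n = lser_of_poly p n].
Proof.
elim: t A alpha => [|t IH] A alpha sA La poA invA.
  exists (A 0%N), 1; split; rewrite ?coprimep1 ?oner_eq0 ?size_poly1//=.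
  - by rewrite tofrac1 divr1.
  - by case: (size _).
  case=> n // _; rewrite /poly_act size_poly1 big_ord1 coef1 mul1r subr0.
  by rewrite poA.
have [p [q [cpq q0 pqE sp app]]] := IH _ _ (fun i => sA i.+1) (fun i => La i.+1)
  (fun i => poA i.+1) (fun i => invA i.+1).
have {}sp := sp (sA 0%N).
have sA1 := sA 0%N.
have p0 : p != 0.
  by rewrite -size_poly_gt0 sp addn_gt0 size_poly_gt0 q0.
have pf0 : tofrac p != 0 by rewrite tofrac_eq0.
have qf0 : tofrac q != 0 by rewrite tofrac_eq0.
exists (A 0%N * p + q), p; split => //.
- by rewrite coprimep_sym coprimep_addl_mul.
- have -> : cf_finite A t.+1 = tofrac (A 0%N) + (tofrac p / tofrac q)^-1.
    by rewrite pqE.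
  rewrite [in LHS]tofracD [in LHS]tofracM.
  move: (tofrac p) (tofrac q) (tofrac _) pf0 => x y w x0.
  by rewrite invf_div mulrDl mulfK.
- move=> sA0; have A00 : A 0%N != 0 by rewrite -size_poly_gt0 ltnW.
  have q_gt0 : (0 < size q)%N by rewrite size_poly_gt0.
  have sAp : size (A 0%N * p) = (size (A 0%N) + size p).-1 by rewrite size_mul.
  by rewrite size_polyDl sAp; lia.
set r := fun n => alpha 0%N n - lser_of_poly (A 0%N) n.
have Lr : is_laurent r.
  have [d ad] := La 0%N; exists (Num.max d (size (A 0%N))%:Z) => n.
  by rewrite gt_max => /andP[dn sn]; rewrite /r ad// lser_of_poly_deg ?subrr.
have al1 : deg_le (alpha 1%N) ((size (A 1%N)).-1)%:Z.
  by case=> n // sn; rewrite poA nth_default// (leq_trans (leqSpred _)).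
have rdeg : deg_le r (- ((size (A 1%N)).-1)%:Z).
  apply: (deg_inverse r (alpha 1%N)) => //.
    by rewrite poA -/(lead_coef _) lead_coef_eq0 -size_poly_gt0 ltnW.
  by move=> [[|n]|n] //= _; rewrite invA /= coef1.
move=> n pn.
have -> : poly_act p (alpha 0%N) n = poly_act p (lser_of_poly (A 0%N)) n + poly_act p r n.
  rewrite /poly_act -big_split /=; apply: eq_bigr => k _.
  by rewrite -mulrDr /r [lser_of_poly _ _ + _]addrC subrK.
rewrite poly_act_poly mulrC.
have lD (u v : {poly rat}) : lser_of_poly (u + v) n = lser_of_poly u n + lser_of_poly v n.
  by case: n {pn} => k /=; rewrite ?coefD ?addr0.
rewrite lD; congr (_ + _); apply/eqP; rewrite -subr_eq0; apply/eqP.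
rewrite -lmul_polyr.
have -> : lser_of_poly q n = lmul r (poly_act q (alpha 1%N)) n.
  by rewrite -poly_act_lmul// invA poly_act_poly mulr1.
have Lq : is_laurent (poly_act q (alpha 1%N)).
  by exists (((size (A 1%N)).-1)%:Z + (size q)%:Z); apply: poly_act_deg.
have Lp : is_laurent (lser_of_poly p) by exists (size p)%:Z; apply: lser_of_poly_deg.
rewrite -lmulBr//.
apply: (lmul_deg _ _ _ (- (size q)%:Z) rdeg); last by lia.
by move=> m qm; rewrite app// subrr.
Qed.

(** Fractions in lowest terms agree up to a constant, so the remainder estimate
    does not depend on how the convergent is scaled. *)
Lemma convergent_approx (g : lser) (A : nat -> {poly rat}) (t : nat) (P Q : {poly int}) :
  cf_expansion g A -> is_convergent A t P Q ->
  forall n, - (size Q)%:Z < n ->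
  poly_act (polyZtoQ Q) g n = lser_of_poly (polyZtoQ P) n.
Proof.
move=> [sA [alpha [<- La poA invA]]] [Q0 cPQ PQE].
have [p [q [cpq q0 pqE _ app]]] := cf_finite_approx t A alpha sA La poA invA.
have sQ : size (polyZtoQ Q) = size Q.
  by apply: size_map_inj_poly => //; apply: intr_inj.
have Qr0 : polyZtoQ Q != 0 by rewrite -size_poly_gt0 sQ size_poly_gt0.
rewrite -sQ; move: (polyZtoQ P) (polyZtoQ Q) Qr0 cPQ PQE => {sQ Q0 P Q} P Q Q0 cPQ PQE.
have cross : P * q = p * Q.
  have : tofrac P / tofrac Q = tofrac p / tofrac q by rewrite PQE pqE.
  move/eqP; rewrite eqr_div ?tofrac_eq0// -!tofracM tofrac_eq.
  by move/eqP.
have : q %= Q.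
  have dvd_q : q %| Q by rewrite -(@Gauss_dvdpr _ Q p q) 1?coprimep_sym// -cross dvdp_mull.
  have dvd_Q : Q %| q by rewrite -(@Gauss_dvdpr _ q P Q) 1?coprimep_sym// cross dvdp_mull.
  by rewrite /eqp dvd_q.
move=> qQ; have [[c1 c2] /andP[/= c10 c20] e] := eqpP _ _ qQ.
pose c := c1 / c2.
have Qc : Q = c *: q by rewrite /c mulrC -scalerA e scalerA mulVf// scale1r.
have c0 : c != 0 by rewrite mulf_neq0 ?invr_eq0.
have Pc : P = c *: p.
  by apply: (mulIf q0); rewrite cross Qc -scalerAr -scalerAl.
move=> n; rewrite Qc size_scale// => nq.
transitivity (c * poly_act q (alpha 0%N) n).
  rewrite /poly_act size_scale// mulr_sumr; apply: eq_bigr => k _.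
  by rewrite coefZ mulrA.
by rewrite app// Pc; case: n {nq} => k /=; rewrite ?coefZ ?mulr0.
Qed.

(** * Real approximations of f_2 *)

(** The numerator of the partial product of [f_2]: the reversed polynomial of
    [f2_partial N], equal to [x^(2^N - 1) * \prod_(t < N) (1 - x^-(2^t))]. *)
Definition f2_numer (N : nat) : {poly int} := \prod_(t < N) ('X^(2 ^ t) - 1).

Lemma f2_numerS (N : nat) : f2_numer N.+1 = f2_numer N * 'X^(2 ^ N) - f2_numer N.
Proof. by rewrite /f2_numer big_ord_recr /= mulrBr mulr1. Qed.

Lemma size_f2_numer (N : nat) : (size (f2_numer N) <= 2 ^ N)%N.
Proof.
elim: N => [|N IH]; first by rewrite /f2_numer big_ord0 size_poly1.
rewrite f2_numerS (leq_trans (size_polyD _ _))// size_polyN geq_max.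
have V0 : f2_numer N != 0.
  by apply/prodf_neq0 => t _; rewrite monic_neq0// monicXnsubC// expn_gt0.
by rewrite size_mulXn// expnS mul2n -addnn leq_add2l IH (leq_trans IH)// leq_addl.
Qed.

Lemma size_f2_partial (N : nat) : (size (f2_partial N) <= 2 ^ N)%N.
Proof.
elim: N => [|N IH]; first by rewrite /f2_partial big_ord0 size_poly1.
rewrite /f2_partial big_ord_recr /= mulrBr mulr1 (leq_trans (size_polyD _ _))//.
rewrite size_polyN geq_max expnS mul2n -addnn.
rewrite (leq_trans IH) ?leq_addl//= (leq_trans (size_polyMleq _ _))//.
by rewrite size_polyXn addnS/= leq_add.
Qed.

Lemma f2_numer_coef_rev (N i : nat) : (i < 2 ^ N)%N ->
  ((f2_numer N)`_i)%:~R = (f2_partial N)`_(2 ^ N - i.+1) :> rat.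
Proof.
elim: N i => [|N IH] i.
  rewrite /f2_numer /f2_partial !big_ord0 expn0 ltnS leqn0 => /eqP->.
  by rewrite !coef1.
move=> iN.
have -> : f2_partial N.+1 = f2_partial N - f2_partial N * 'X^(2 ^ N).
  by rewrite /f2_partial big_ord_recr /= mulrBr mulr1.
have sP := size_f2_partial N.
rewrite f2_numerS !coefB !coefMXn intrD rmorphN /=.
move: iN; rewrite expnS mul2n -addnn => iN.
case: ltnP => iN2.
  have -> : (2 ^ N + 2 ^ N - i.+1 < 2 ^ N)%N = false by lia.
  rewrite IH// [(f2_partial N)`_(2 ^ N + _ - _)]nth_default ?(leq_trans sP)//; last by lia.
  by rewrite !sub0r; congr (- _`__); lia.
have -> : (2 ^ N + 2 ^ N - i.+1 < 2 ^ N)%N by lia.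
rewrite [(f2_numer N)`_i]nth_default ?(leq_trans (size_f2_numer N))// !subr0.
by rewrite IH; [congr (_`__)|]; lia.
Qed.

Lemma f2_numer_coef_le1 (N i : nat) : `|(f2_numer N)`_i| <= 1.
Proof.
elim: N i => [|N IH] i; first by rewrite /f2_numer big_ord0 coef1; case: eqP.
rewrite f2_numerS coefB coefMXn; case: ltnP => iN; first by rewrite sub0r normrN.
by rewrite [(f2_numer N)`_i]nth_default ?(leq_trans (size_f2_numer N))// subr0.
Qed.

(** Seen from the top, [f2_numer N] agrees with [x^(2^N) g_2(x)]. The [N] leading
    places suffice: the estimate of a remainder [Q g_2 - P] reads fewer than
    [2 * size Q] of them. *)
Lemma f2_numer_coef_g2 (N i : nat) : (2 ^ N - N <= i)%N ->
  ((f2_numer N)`_i)%:~R = g2 (i%:Z - (2 ^ N)%N%:Z).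
Proof.
move=> Ni; have NN : (N < 2 ^ N)%N by apply: ltn_expl.
have [iN|iN] := ltnP i (2 ^ N).
  rewrite f2_numer_coef_rev// (@f2_partialE _ N); last by lia.
  by rewrite /g2; congr f2; lia.
rewrite nth_default ?(leq_trans (size_f2_numer N))//.
by rewrite /g2 /f2 ifF//; lia.
Qed.

Definition coef_norm (Q : {poly int}) : int := \sum_(k < size Q) `|Q`_k|.

Lemma coef_norm_ge (Q : {poly int}) (M : nat) : \sum_(k < M) `|Q`_k| <= coef_norm Q.
Proof.
rewrite -(big_mkord xpredT (fun k => `|Q`_k|)) /coef_norm.
rewrite -(big_mkord xpredT (fun k => `|Q`_k|)).
have [MQ|QM] := leqP M (size Q).
  by rewrite [leRHS](big_cat_nat (n := M))//= lerDl sumr_ge0.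
rewrite (big_cat_nat (n := size Q)) ?(ltnW QM)//= gerDl big_nat_cond big1//.
by move=> i /andP[/andP[Qi _] _]; rewrite nth_default ?normr0.
Qed.

Lemma horner_le_geometric (W : {poly int}) (B z : int) (M : nat) :
  (forall i, `|W`_i| <= B) -> (size W <= M.+1)%N -> 2 <= z ->
  `|W.[z]| <= 2 * B * z ^+ M.
Proof.
move=> WB sW z2; have z0 : 0 <= z by lia.
have B0 : 0 <= B by apply: le_trans (WB 0%N).
rewrite (horner_coef_wide _ sW) (le_trans (ler_norm_sum _ _ _))//.
apply: (@le_trans _ _ (B * \sum_(i < M.+1) z ^+ i)).
  rewrite mulr_sumr; apply: ler_sum => i _.
  by rewrite normrM normrX (ger0_norm z0) ler_wpM2r// exprn_ge0.
rewrite [2 * B]mulrC -mulrA ler_wpM2l//.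
elim: M {sW} => [|M IH]; first by rewrite big_ord1 expr0.
rewrite big_ord_recr /= (le_trans (lerD IH (lexx _)))//.
have : 2 * z ^+ M <= z ^+ M.+1 by rewrite exprS ler_wpM2r// exprn_ge0.
by move: (z ^+ M.+1) (z ^+ M) => u v; lia.
Qed.

(** [Q f2_numer_N - P x^(2^N)] is a polynomial truncation of
    [x^(2^N) (Q g_2 - P)], so the vanishing of the top coefficients of
    [Q g_2 - P] bounds its degree. *)
Lemma remainder_size (P Q : {poly int}) (N : nat) :
  (forall n : int, - (size Q)%:Z < n ->
     poly_act (polyZtoQ Q) g2 n = lser_of_poly (polyZtoQ P) n) ->
  (2 * size Q <= N)%N ->
  (size (Q * f2_numer N - P * 'X^(2 ^ N))%R <= (2 ^ N - size Q).+1)%N.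
Proof.
move=> app QN; have NN : (N < 2 ^ N)%N by apply: ltn_expl.
apply/leq_sizeP => m Qm; apply: (@intr_inj rat).
have sQ : size (polyZtoQ Q) = size Q.
  by apply: size_map_inj_poly => //; apply: intr_inj.
have nQ : - (size Q)%:Z < m%:Z - (2 ^ N)%N%:Z by lia.
rewrite coefB intrD rmorphN /=; apply/eqP; rewrite subr_eq0; apply/eqP.
transitivity (poly_act (polyZtoQ Q) g2 (m%:Z - (2 ^ N)%N%:Z)).
  rewrite (@poly_act_widen _ _ _ m.+1) ?sQ; last by lia.
  rewrite coefM rmorph_sum /=; apply: eq_bigr => k _.
  rewrite rmorphM /= coef_map; have [kQ|Qk] := ltnP k (size Q); last first.
    by rewrite [Q`_k]nth_default// !mul0r.
  by rewrite f2_numer_coef_g2; [congr (_ * g2 _)|]; have := ltn_ord k; lia.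
rewrite app// coefMXn; case: ltnP => mN.
  by case E: (m%:Z - _) => [k|k] //; lia.
by rewrite subzn//= coef_map.
Qed.

(** The coefficients of the truncated remainder are bounded independently of [N],
    as those of [f2_numer N] are 0, 1 or -1; with the degree bound this
    controls its values. *)
Lemma remainder_horner_le (P Q : {poly int}) (z : int) (N : nat) : Q != 0 ->
  (forall n : int, - (size Q)%:Z < n ->
     poly_act (polyZtoQ Q) g2 n = lser_of_poly (polyZtoQ P) n) ->
  2 <= z -> (2 * size Q <= N)%N ->
  `|Q.[z] * (f2_numer N).[z] - P.[z] * z ^+ (2 ^ N)|
    <= 2 * coef_norm Q * z ^+ (2 ^ N - size Q).
Proof.
move=> Q0 app z2 QN; have sW := remainder_size P Q N app QN.
have NN : (N < 2 ^ N)%N by apply: ltn_expl.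
have Qs : (0 < size Q)%N by rewrite size_poly_gt0.
have := horner_le_geometric _ (coef_norm Q) z _ _ sW z2.
rewrite !hornerE; apply=> i.
have [iQ|Qi] := leqP i (2 ^ N - size Q); last first.
  by rewrite nth_default ?(leq_trans sW)// normr0 sumr_ge0.
rewrite coefB coefMXn ifT ?subr0; last by lia.
rewrite coefM (le_trans (ler_norm_sum _ _ _))//.
apply: le_trans (coef_norm_ge Q i.+1); apply: ler_sum => k _.
by rewrite normrM ler_piMr// f2_numer_coef_le1.
Qed.

Lemma f2_partial_real_numer (R : realType) (z : int) (N : nat) : z != 0 ->
  f2_partial_real (z%:~R : R) N * z%:~R ^+ (2 ^ N) = (z * (f2_numer N).[z])%:~R.
Proof.
move=> z0; have zR : (z%:~R : R) != 0 by rewrite intr_eq0.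
elim: N => [|N IH].
  by rewrite /f2_partial_real /f2_numer !big_ord0 hornerC mul1r mulr1 expr1.
rewrite /f2_partial_real big_ord_recr /= -/(f2_partial_real _ _).
rewrite f2_numerS expnS mul2n -addnn exprD !hornerE.
have -> : z * ((f2_numer N).[z] * z ^+ (2 ^ N) - (f2_numer N).[z]) =
    z * (f2_numer N).[z] * (z ^+ (2 ^ N) - 1) by ring.
rewrite intrM -IH intrB rmorphXn /=.
by field; rewrite expf_neq0.
Qed.

Section Limits.
Import numFieldNormedType.Exports.
Local Open Scope classical_set_scope.

(** The limit, as [N] tends to infinity, of the estimate for the truncated
    remainders. *)
Lemma f2_real_approx (R : realType) (P Q : {poly int}) (z : int) : Q != 0 ->
  (forall n : int, - (size Q)%:Z < n ->
     poly_act (polyZtoQ Q) g2 n = lser_of_poly (polyZtoQ P) n) ->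
  2 <= z ->
  `|Q.[z]%:~R * f2_real (z%:~R : R) - (z * P.[z])%:~R| * z%:~R ^+ size Q
    <= (2 * coef_norm Q * z)%:~R.
Proof.
move=> Q0 app z2; set x : R := z%:~R.
have z0 : z != 0 by apply: contraTneq z2 => ->.
have x1 : 1 < x by rewrite -[1]/(1%:~R) ltr_int; lia.
have x0 : 0 < x by apply: lt_trans x1.
have cF := cvg_f2_partial_real x1.
have cu : (fun N => `|Q.[z]%:~R * f2_partial_real x N - (z * P.[z])%:~R| * x ^+ size Q)
   @ \oo --> `|Q.[z]%:~R * f2_real x - (z * P.[z])%:~R| * x ^+ size Q.
  apply: cvgMl; apply: cvg_norm; apply: cvgB; last exact: cvg_cst.
  by apply: cvgMr.
rewrite -(cvg_lim _ cu)//; apply: limr_le; first by apply/cvg_ex; eexists; exact: cu.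
near=> N.
have QN : (2 * size Q <= N)%N by near: N; exists (2 * size Q)%N.
have NN : (N < 2 ^ N)%N by apply: ltn_expl.
have xN0 : 0 < x ^+ (2 ^ N - size Q) by rewrite exprn_gt0.
rewrite -(ler_pM2r xN0) -(mulrA `|_|) -exprD subnKC; last by lia.
rewrite -[x ^+ (2 ^ N)]gtr0_norm ?exprn_gt0// -normrM mulrBl -[Q.[z]%:~R * _ * _]mulrA.
rewrite /x f2_partial_real_numer//.
have intrX k : (z%:~R : R) ^+ k = (z ^+ k)%:~R by rewrite rmorphXn.
rewrite !intrX -!intrM -intrB.
rewrite -intr_norm ler_int.
have -> : Q.[z] * (z * (f2_numer N).[z]) - z * P.[z] * z ^+ (2 ^ N) =
   z * (Q.[z] * (f2_numer N).[z] - P.[z] * z ^+ (2 ^ N)) by ring.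
rewrite normrM ger0_norm; last by lia.
rewrite [leRHS](_ : _ = z * (2 * coef_norm Q * z ^+ (2 ^ N - size Q))); last by ring.
by rewrite ler_pM2l; [exact: remainder_horner_le|lia].
Unshelve. all: by end_near. Qed.

Lemma f2_real_iter (R : realType) (x : R) (n : nat) : 1 < x ->
  f2_real x = f2_partial_real x n * f2_real (x ^+ (2 ^ n)).
Proof.
move=> x1; have y1 : 1 < x ^+ (2 ^ n) by rewrite exprn_egt1// expn_eq0.
have cF := cvg_f2_partial_real x1.
have cG := cvg_f2_partial_real y1.
have split N : f2_partial_real x (N + n) =
    f2_partial_real x n * f2_partial_real (x ^+ (2 ^ n)) N.
  rewrite /f2_partial_real addnC big_split_ord /=; congr (_ * _).
  by apply: eq_bigr => i _; rewrite -exprM -expnD.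
have : (fun N => f2_partial_real x (N + n)) @ \oo --> f2_real x.
  by rewrite (cvg_shiftn n (f2_partial_real x)).
have : (fun N => f2_partial_real x (N + n)) @ \oo -->
    f2_partial_real x n * f2_real (x ^+ (2 ^ n)).
  by rewrite (funext split); apply: cvgMr.
by move=> h1 h2; apply: (cvg_unique _ h2 h1).
Qed.

End Limits.

(** * Common factors and the conclusion *)

Lemma f2_numer_horner_bound (a : int) (n : nat) : 1 <= a ->
  0 <= (f2_numer n).[a] /\ a * (f2_numer n).[a] <= a ^+ (2 ^ n).
Proof.
move=> a1; elim: n => [|n [V0 Vle]].
  by rewrite /f2_numer big_ord0 hornerC ler01 mulr1 expr1.
have b1 : 1 <= a ^+ (2 ^ n) by apply: exprn_ege1.
rewrite f2_numerS !hornerE.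
have -> : (f2_numer n).[a] * a ^+ (2 ^ n) - (f2_numer n).[a] =
  (f2_numer n).[a] * (a ^+ (2 ^ n) - 1) by ring.
split; first by rewrite mulr_ge0// subr_ge0.
rewrite mulrA expnS mul2n -addnn exprD ler_pM ?subr_ge0 ?gerBl//.
by rewrite mulr_ge0//; lia.
Qed.

Lemma f2_numer_dvd (p : nat) (a : int) (n0 m : nat) :
  (p%:Z %| a ^+ (2 ^ n0) - 1)%Z -> (p%:Z ^+ m %| (f2_numer (n0 + m)).[a])%Z.
Proof.
move=> pa; elim: m => [|m IH]; first by rewrite expr0 dvd1z.
rewrite addnS f2_numerS !hornerE.
have -> : (f2_numer (n0 + m)).[a] * a ^+ (2 ^ (n0 + m)) - (f2_numer (n0 + m)).[a] =
  (f2_numer (n0 + m)).[a] * (a ^+ (2 ^ (n0 + m)) - 1) by ring.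
rewrite exprSr; apply: dvdz_mul => //.
by rewrite expnD exprM subrX1; apply: dvdz_mulr.
Qed.

Lemma coef_le_norm (Q : {poly int}) (i : nat) : `|Q`_i| <= coef_norm Q.
Proof.
apply: le_trans (coef_norm_ge Q i.+1).
by rewrite big_ord_recr /= lerDr sumr_ge0.
Qed.

(** Here [x] is [z], [X] is [z^(deg Q + 1)], and [Q(z) = s * D] and
    [V_n(a) = v * D] share the factor [D]. Both the size of [Q(z)] and the
    distance of [Q(z) f_2(a)] to the numerator are divided by [D] in the
    simplified fraction, whence the [D^2]. *)
Lemma approximation_quality {R : realFieldType} {x X D s v a F f y B c : R} :
  0 < x -> 0 < X -> 0 < D -> s != 0 ->
  F * x = a * (v * D) -> `|s * D * f - x * y| * X <= 2 * B * x ->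
  0 <= a * (v * D) <= x -> `|s * D| * x <= 2 * B * X ->
  4 * B ^+ 2 < c * D ^+ 2 ->
  `|F * f - a * v * y / s| < c / s ^+ 2.
Proof.
move=> x0 X0 D0 s0 numer f2z /andP[V0 Vle] Qle Dc.
set Delta := s * (F * f) - a * v * y.
have DeltaE : D * Delta * x = a * (v * D) * (s * D * f - x * y).
  transitivity (D * s * f * (F * x) - D * a * v * y * x); first by rewrite /Delta; ring.
  by rewrite numer; ring.
have B0 : 0 <= B * x.
  have : 0 <= 2 * B * x by apply: le_trans f2z; rewrite mulr_ge0// ltW.
  by rewrite -mulrA pmulr_rge0.
have Dle : D * `|Delta| * X <= 2 * B * x.
  have normE : `|D * Delta * x| = D * `|Delta| * x.
    by rewrite !normrM (gtr0_norm D0) (gtr0_norm x0).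
  rewrite -(ler_pM2r x0) mulrAC -normE DeltaE normrM (ger0_norm V0) -(mulrA _ `|_|).
  apply: le_trans (ler_wpM2l V0 f2z) _.
  by rewrite mulrC ler_wpM2l// -mulrA mulr_ge0.
have -> : F * f - a * v * y / s = Delta / s by rewrite /Delta; field.
rewrite normrM normfV ltr_pdivlMr ?exprn_even_gt0//= -real_normK ?num_real//.
have -> : `|Delta| / `|s| * `|s| ^+ 2 = `|Delta| * `|s| by field; rewrite normr_eq0.
rewrite normrM (gtr0_norm D0) in Qle.
rewrite -(ltr_pM2r (exprn_gt0 2 D0)) -(ltr_pM2r (mulr_gt0 x0 X0)).
apply: (@le_lt_trans _ _ (4 * B ^+ 2 * (x * X))); last by rewrite ltr_pM2r// mulr_gt0.
rewrite [leLHS](_ : _ = (D * `|Delta| * X) * (`|s| * D * x)); last by ring.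
rewrite [leRHS](_ : _ = (2 * B * x) * (2 * B * X)); last by ring.
by apply: ler_pM => //; rewrite !mulr_ge0// ltW.
Qed.

Theorem theorem3 (R : realType) (a : int) (ha : 2 <= a)
    (A : nat -> {poly rat}) (hA : cf_expansion g2 A)
    (P Q : nat -> {poly int}) (hPQ : forall t : nat, is_convergent A t (P t) (Q t))
    (h : exists n0 t p : nat,
      [/\ (0 < n0)%N, (0 < t)%N & (0 < p)%N] /\
      [/\ [/\ prime p, odd p & exactly_divides p%:Z (a ^+ (2 ^ n0) - 1)],
          #|Gamma 2 p 2| = (p * #|Gamma 2 p 1|)%N,
          ((p ^ 2)%N%:Z %| (Q t).[a ^+ (2 ^ n0)])%Z &
          ~~ (p%:Z %| ((Q t)^`()).[1])%Z]) :
  ~ badly_approximable (f2_real (a%:~R : R)).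
Proof.
have a_ge0 : 0 <= a by rewrite (le_trans _ ha).
have a_ge1 : 1 <= a by rewrite (le_trans _ ha).
case: h => n0 [t [p [_ [[pp op pa] card2 Qa Q1]]]] [c [c0 bad]].
have [Q0 _ _] := hPQ t.
have app := convergent_approx g2 A t (P t) (Q t) hA (hPQ t).
move: (P t) (Q t) Qa Q1 Q0 app => {hA hPQ P}P {}Q Qa Q1 Q0 app.
have [e [w [e0 ew pw]]] := two_order_lift p pp op card2.
have {}Qa : (p%:Z ^+ 2 %| Q.[a ^+ (2 ^ n0)])%Z by rewrite -[p%:Z]natz -natrX natz.
have lift := lift_power_root p e Q (a ^+ (2 ^ n0)) w pp op e0 ew pw pa Qa Q1.
pose QR : {poly R} := map_poly intr Q.
have QR0 : QR != 0 by rewrite map_poly_eq0_id0// intr_eq0 lead_coef_eq0.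
have [b Qb] := Cauchy_root_bound QR0.
pose B : R := (coef_norm Q)%:~R.
have B0 : 0 <= B by rewrite ler0z sumr_ge0.
(* The first bound on [k] puts [z] beyond the roots of [Q]; the second makes
   [p^k] beat the constant [c]. *)
pose k := maxn (Num.bound `|b|) (Num.bound (4 * B ^+ 2 / c)).
have kb : `|b| < k%:R.
  by apply: lt_le_trans (archi_boundP _) _; rewrite ?normr_ge0// ler_nat leq_maxl.
have kB : 4 * B ^+ 2 / c < k%:R.
  apply: lt_le_trans (archi_boundP _) _; last by rewrite ler_nat leq_maxr.
  by rewrite divr_ge0 ?(ltW c0)// mulr_ge0// sqr_ge0.
have [m km pQ] := lift k.
rewrite -exprM -expnD in pQ.
set z := a ^+ (2 ^ (n0 + m)) in pQ.
have kz : k%:Z < z.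
  apply: (@le_lt_trans _ _ (2 ^ (n0 + m))%N%:Z).
    by rewrite lez_nat (leq_trans km)// (leq_trans (leq_addl n0 m))// ltnW// ltn_expl.
  rewrite (@lt_le_trans _ _ (2%:Z ^+ (2 ^ (n0 + m))))//; last by rewrite lerXn2r ?nnegrE.
  by rewrite -[2%:Z]natz -natrX natz ltz_nat ltn_expl.
have z2 : 2 <= z.
  by rewrite (le_trans ha)// -[leLHS]expr1 ler_weXn2l ?expn_gt0// (le_trans _ ha).
have Qz0 : Q.[z] != 0.
  apply/eqP => Qz; have : root QR z%:~R by rewrite /root horner_map/= Qz.
  move/Qb; apply/negP; rewrite -ltNge (le_lt_trans (ler_norm b))//.
  rewrite (lt_le_trans kb)// (le_trans _ (ler_norm _))//.
  by rewrite -[k%:R]/(k%:~R) ler_int ltW.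
have a0 : a != 0 by apply: contraTneq ha => ->.
have [V0 Vle] := f2_numer_horner_bound a (n0 + m) a_ge1.
have [/dvdzP[s Qs] /dvdzP[v Vv]] :
    (p%:Z ^+ k %| Q.[z])%Z /\ (p%:Z ^+ k %| (f2_numer (n0 + m)).[a])%Z.
  split; first by apply: dvdz_trans pQ; apply: dvdz_exp2l; rewrite -addn2 leq_addr.
  apply: dvdz_trans (f2_numer_dvd p a n0 m _); first exact: dvdz_exp2l.
  by case/andP: pa.
have s0 : s != 0 by apply: contraNneq Qz0 => s0; rewrite Qs s0 mul0r.
have [_] := bad (a * v * P.[z]) s s0; apply/negP; rewrite -ltNge.
have f2z := f2_real_approx R P Q z Q0 app z2.
have a1 : 1 < (a%:~R : R) by rewrite -[1]/(1%:~R) ltr_int (lt_le_trans _ ha).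
have f2a := f2_real_iter R a%:~R (n0 + m) a1.
have numer := f2_partial_real_numer R a (n0 + m) a0.
rewrite -rmorphXn /= -/z in f2a numer.
have Qle : `|Q.[z]| * z <= 2 * coef_norm Q * z ^+ size Q.
  have := horner_le_geometric Q (coef_norm Q) z (size Q).-1 (coef_le_norm Q) (leqSpred _) z2.
  have z_ge0 : 0 <= z by apply: le_trans z2.
  move=> /(ler_wpM2r z_ge0)/le_trans; apply.
  by rewrite -[leLHS]mulrA -exprSr prednK// size_poly_gt0.
move: Qle; rewrite -(ler_int R) !intrM intr_norm.
have -> : (z ^+ size Q)%:~R = z%:~R ^+ size Q :> R by rewrite rmorphXn.
move: f2z Vle V0; rewrite -(ler_int R) -(ler_int R 0) !intrM /= -/B.
rewrite intrM in numer.
have x0 : 0 < (z%:~R : R) by rewrite ltr0z; apply: lt_le_trans z2.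
have D0 : 0 < (p%:R : R) ^+ k by rewrite exprn_gt0// ltr0n prime_gt0.
have Dk : k%:R < (p%:R : R) ^+ k by rewrite -natrX ltr_nat ltn_expl// prime_gt1.
have EQ : Q.[z]%:~R = s%:~R * p%:R ^+ k :> R by rewrite Qs intrM rmorphXn.
have EV : (f2_numer (n0 + m)).[a]%:~R = v%:~R * p%:R ^+ k :> R by rewrite Vv intrM rmorphXn.
have sR0 : (s%:~R : R) != 0 by rewrite intr_eq0.
rewrite EV in numer *; rewrite EQ f2a.
move=> f2z Vle V0 Qle.
have Dc : 4 * B ^+ 2 < c * (p%:R ^+ k) ^+ 2.
  rewrite [ltRHS]mulrC -ltr_pdivrMr// (lt_trans kB)// (lt_le_trans Dk)//.
  by rewrite ler_eXnr// exprn_ege1// ler1n prime_gt0.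
have X0 : 0 < (z%:~R : R) ^+ size Q by rewrite exprn_gt0.
have V01 : 0 <= (a%:~R : R) * (v%:~R * p%:R ^+ k) <= (z%:~R : R).
  by apply/andP; split=> //; apply: mulr_ge0; rewrite ?ler0z.
exact: (approximation_quality x0 X0 D0 sR0 numer f2z V01 Qle Dc).
Qed.
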